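(* Let $r>0$ and $\alpha\in\mathbb{R}$. The delay logistic equation $$\frac{d}{dt}x(t)=r\,x(t)\left(1+\alpha x(t)-x(t-1)\right)$$ has a blow-up solution (for some positive continuous initial function on $[-1,0]$) if and only if $\alpha>0$.
   Context: An initial condition is a positive continuous function $\phi:[-1,0]\to(0,\infty)$. The corresponding solution is the continuous function $x$ on its maximal interval of existence $[-1,T)$, $0<T\le\infty$, with $x(\theta)=\phi(\theta)$ for $\theta\in[-1,0]$ and satisfying the differential equation for $0\le t<T$ (right-hand derivative at $t=0$). A blow-up solution is a solution that converges to infinity in finite time, i.e. one with $T<\infty$ and $\lim_{t\to T^-}x(t)=\infty$. *)

(* Defs.v *)
From Stdlib Require Import Reals.
From Coquelicot Require Import Coquelicot.
Open Scope R_scope.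

Definition initial_condition (phi : R -> R) : Prop :=
  (forall theta, -1 <= theta <= 0 -> 0 < phi theta) /\
  continuous_on (fun theta => -1 <= theta <= 0) phi.

Definition logistic_rhs (r alpha : R) (x : R -> R) (t : R) : R :=
  r * x t * (1 + alpha * x t - x (t - 1)).

(* A function on [-1, T) is represented by a total function whose values
   outside [-1, T) are irrelevant: every clause below only looks at
   [-1, T), which is why continuity is relative to that interval and the
   equation at t = 0 involves the right-hand derivative. *)
Definition solution_on (r alpha : R) (phi : R -> R) (T : Rbar) (x : R -> R)
    : Prop :=
  Rbar_lt 0 T /\
  continuous_on (fun t => -1 <= t /\ Rbar_lt t T) x /\
  (forall theta, -1 <= theta <= 0 -> x theta = phi theta) /\
  filterlim (fun t => (x t - x 0) / (t - 0)) (at_right 0)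
    (locally (logistic_rhs r alpha x 0)) /\
  (forall t : R, 0 < t -> Rbar_lt t T ->
    is_derive x t (logistic_rhs r alpha x t)).

Definition maximal_solution (r alpha : R) (phi : R -> R) (T : Rbar)
    (x : R -> R) : Prop :=
  solution_on r alpha phi T x /\
  (forall (T' : Rbar) (y : R -> R),
    Rbar_lt T T' -> solution_on r alpha phi T' y ->
    ~ (forall t : R, -1 <= t -> Rbar_lt t T -> y t = x t)).

(* The end point T ranges over R, not Rbar: this is the condition T < oo. *)
Definition blow_up_solution (r alpha : R) (phi x : R -> R) : Prop :=
  exists T : R,
    maximal_solution r alpha phi T x /\
    filterlim x (at_left T) (Rbar_locally p_infty).

(* Main.v *)
(** If [alpha <= 0], a solution stays positive, so the delayed and the quadratic
    terms can only slow the growth down and [x t <= x 0 * exp (r t)], which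
    excludes blow-up in finite time.

    If [alpha > 0], take [phi = 1] on [[-1, -1/2]] and let it rise linearly to
    [c = 2 / (r alpha)] at [0].  On [[0, 1/2)] the delayed term then cancels the
    [1], the equation becomes [x' = r alpha x^2], and its solution
    [c / (1 - 2 t)] blows up at [1/2], before the ramp of [phi] is seen. *)

Require Import Defs.
From Stdlib Require Import Reals Lra.
From Coquelicot Require Import Coquelicot.
Open Scope R_scope.

(** * Clamping to an interval and calculus preliminaries *)

Definition clamp (a b t : R) : R := Rmax a (Rmin b t).

Lemma clamp_bounds (a b t : R) : a <= b -> a <= clamp a b t <= b.
Proof.
intros Hab; unfold clamp, Rmax, Rmin.
repeat destruct Rle_dec; lra.
Qed.

Lemma clamp_id (a b t : R) : a <= t <= b -> clamp a b t = t.
Proof.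
intros Ht; unfold clamp, Rmax, Rmin.
repeat destruct Rle_dec; lra.
Qed.

Lemma continuous_Rmax_r (a t : R) : continuous (Rmax a) t.
Proof.
apply (continuous_ext (fun u => (a + u + Rabs (a - u)) / 2)).
  intros u; unfold Rmax, Rabs; destruct Rle_dec, Rcase_abs; lra.
apply continuity_pt_filterlim; reg.
Qed.

Lemma continuous_Rmin_r (b t : R) : continuous (Rmin b) t.
Proof.
apply (continuous_ext (fun u => (b + u - Rabs (b - u)) / 2)).
  intros u; unfold Rmin, Rabs; destruct Rle_dec, Rcase_abs; lra.
apply continuity_pt_filterlim; reg.
Qed.

(** As [clamp a b] is continuous with values in [[a, b]], continuity relative to [[a, b]] suffices.
    This turns a solution into a function continuous on the whole line, as [IVT_gen] requires. *)
Lemma continuous_comp_clamp (f : R -> R) (a b : R) :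
  a <= b -> continuous_on (fun t => a <= t <= b) f ->
  forall t, continuous (fun u => f (clamp a b u)) t.
Proof.
intros Hab Hf t.
refine (filterlim_comp _ _ _ (clamp a b) f _ _ _ _ (Hf _ (clamp_bounds a b t Hab))).
assert (Hc : continuous (clamp a b) t)
  by (apply (continuous_comp (Rmin b) (Rmax a));
      [apply continuous_Rmin_r | apply continuous_Rmax_r]).
intros P HP; unfold filtermap.
apply (filter_imp (fun u => a <= clamp a b u <= b -> P (clamp a b u))).
  intros u Hu; apply Hu, clamp_bounds, Hab.
exact (Hc _ HP).
Qed.

Lemma derive_nonneg_le (f df : R -> R) (a b : R) :
  a <= b ->
  (forall t, a <= t <= b -> continuous f t) ->
  (forall t, a < t < b -> is_derive f t (df t)) ->
  (forall t, a <= t <= b -> 0 <= df t) ->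
  f a <= f b.
Proof.
intros Hab Hc Hd Hp.
destruct (MVT_gen f a b df) as [c [Hcab Heq]].
- rewrite Rmin_left, Rmax_right by lra; exact Hd.
- rewrite Rmin_left, Rmax_right by lra.
  intros t Ht; apply continuity_pt_filterlim, Hc, Ht.
- rewrite Rmin_left, Rmax_right in Hcab by lra.
  assert (0 <= df c * (b - a)) by (apply Rmult_le_pos; [apply Hp, Hcab | lra]).
  lra.
Qed.

(** * Linear equations [f' = f g]: positivity and exponential bound *)

Lemma continuous_exp_scal (k t : R) : continuous (fun u => exp (k * u)) t.
Proof. apply continuity_pt_filterlim; reg. Qed.

(* The square is used because [(f^2 exp (2 M t))' >= 0] whatever the sign of
   [f]: hence [f] never vanishes. *)
Lemma linear_ode_pos (f g : R -> R) (s : R) :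
  (forall t, continuous f t) -> (forall t, continuous g t) ->
  (forall t, 0 < t < s -> is_derive f t (f t * g t)) ->
  0 < f 0 -> forall t, 0 <= t <= s -> 0 < f t.
Proof.
intros Hf Hg Hd H0 t Ht.
destruct (Rlt_le_dec 0 (f t)) as [|Hneg]; [assumption | exfalso].
(* A nonpositive value forces a zero [u] of [f] in [[0, t]]; monotonicity of [f^2 exp (2 M t)] on
   [[0, u]] then contradicts [0 < f 0]. *)
destruct (IVT_gen f 0 t 0) as [u [Hu Hfu]].
- intros v; apply continuity_pt_filterlim, Hf.
- rewrite Rmin_right, Rmax_left by lra; lra.
- rewrite Rmin_left, Rmax_right in Hu by lra.
  destruct (continuity_ab_maj (fun v => Rabs (g v)) 0 u) as [m [Hm _]]; [lra | |].
    intros v _; apply continuity_pt_filterlim.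
    apply continuous_comp; [apply Hg | apply continuous_Rabs].
  set (M := Rabs (g m)) in *.
  assert (Hle : f 0 * f 0 * exp (2 * M * 0) <= f u * f u * exp (2 * M * u)).
  { apply (derive_nonneg_le (fun v => f v * f v * exp (2 * M * v))
             (fun v => 2 * (f v * f v) * exp (2 * M * v) * (g v + M))).
    - lra.
    - intros v _; apply (continuous_mult (fun v => f v * f v)).
        apply (continuous_mult f f); apply Hf.
      apply continuous_exp_scal.
    - intros v Hv.
      assert (Hdv := Hd v ltac:(lra)).
      auto_derive.
        repeat split; eexists; exact Hdv.
      replace (Derive _ v) with (f v * g v) by (symmetry; exact (is_derive_unique _ _ _ Hdv)); ring.
    - intros v Hv.
      assert (HM := Hm v Hv); simpl in HM.
      assert (- g v <= Rabs (g v)) by (rewrite <- Rabs_Ropp; apply Rle_abs).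
      assert (0 < exp (2 * M * v)) by apply exp_pos.
      assert (0 <= f v * f v) by apply Rle_0_sqr.
      apply Rmult_le_pos; [apply Rmult_le_pos |]; lra. }
  rewrite Hfu, Rmult_0_r, exp_0 in Hle.
  assert (0 < f 0 * f 0) by (apply Rmult_lt_0_compat; lra).
  lra.
Qed.

(** The derivative of [f exp (- k t)] is [f exp (- k t) (g - k) <= 0]. The proof negates this
    function so that [derive_nonneg_le] applies. *)
Lemma linear_ode_le_exp (f g : R -> R) (k s : R) :
  0 <= s ->
  (forall t, continuous f t) ->
  (forall t, 0 < t < s -> is_derive f t (f t * g t)) ->
  (forall t, 0 <= t <= s -> 0 <= f t) ->
  (forall t, 0 <= t <= s -> g t <= k) ->
  f s <= f 0 * exp (k * s).
Proof.
intros Hs Hf Hd Hp Hg.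
assert (Hle : - f 0 * exp (- k * 0) <= - f s * exp (- k * s)).
{ apply (derive_nonneg_le (fun v => - f v * exp (- k * v))
           (fun v => f v * exp (- k * v) * (k - g v))).
  - exact Hs.
  - intros v _; apply (continuous_mult (fun v => - f v)).
      apply (continuous_opp f), Hf.
    apply continuous_exp_scal.
  - intros v Hv.
    assert (Hdv := Hd v Hv).
    auto_derive.
      repeat split; eexists; exact Hdv.
    replace (Derive _ v) with (f v * g v) by (symmetry; exact (is_derive_unique _ _ _ Hdv)); ring.
  - intros v Hv.
    assert (0 < exp (- k * v)) by apply exp_pos.
    assert (Hgv := Hg v Hv); assert (Hfv := Hp v Hv).
    apply Rmult_le_pos; [apply Rmult_le_pos |]; lra. }
rewrite Rmult_0_r, exp_0 in Hle.
replace (f s) with (f s * exp (- k * s) * exp (k * s)).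
  apply Rmult_le_compat_r; [left; apply exp_pos | lra].
rewrite Rmult_assoc, <- exp_plus.
replace (- k * s + k * s) with 0 by ring.
rewrite exp_0; ring.
Qed.

(** * The case [alpha <= 0]: no blow-up *)

Lemma solution_le_exp (r alpha T : R) (phi x : R -> R) :
  0 < r -> alpha <= 0 ->
  initial_condition phi -> solution_on r alpha phi T x ->
  forall s, 0 < s < T -> x s <= x 0 * exp (r * s).
Proof.
intros Hr Ha [Hphi _] [HT [Hcont [Hinit [_ Hder]]]] s Hs; simpl in *.
(* Freezing [x] outside [[-1, s]] yields a globally continuous function satisfying the same equation
   on [(0, s)], in the linear form [X' = X g]. *)
set (X := fun t => x (clamp (-1) s t)).
set (g := fun t => r * (1 + alpha * X t - X (t - 1))).
assert (HX : forall t, -1 <= t <= s -> X t = x t)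
  by (intros t Ht; unfold X; rewrite clamp_id; auto).
assert (HXc : forall t, continuous X t).
{ apply continuous_comp_clamp; [lra |].
  apply continuous_on_subset with (2 := Hcont); intros t Ht; simpl; lra. }
assert (Hgc : forall t, continuous g t).
{ intros t; unfold g.
  assert (HXs : continuous (fun u => X (u - 1)) t).
    apply (continuous_comp (fun u => u - 1) X); [|apply HXc].
    apply continuity_pt_filterlim; reg.
  apply (continuous_scal_r r (fun t => 1 + alpha * X t - X (t - 1))).
  apply (continuous_minus (fun t => 1 + alpha * X t)); [|exact HXs].
  apply (continuous_plus (fun _ => 1)); [apply continuous_const |].
  apply (continuous_scal_r alpha X), HXc. }
assert (HXd : forall t, 0 < t < s -> is_derive X t (X t * g t)).
{ intros t Ht.
  apply (is_derive_ext_loc x).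
    assert (Hl := locally_interval (fun u => x u = X u) t 0 s).
    apply Hl; simpl; try lra; intros u H1 H2; symmetry; apply HX; lra.
  replace (X t * g t) with (logistic_rhs r alpha x t).
    apply Hder; lra.
  unfold logistic_rhs, g; rewrite !HX by lra; ring. }
assert (HX0 : forall t, -1 <= t <= 0 -> 0 < X t)
  by (intros t Ht; rewrite HX, Hinit by lra; apply Hphi, Ht).
assert (HXp := linear_ode_pos X g s HXc Hgc HXd (HX0 0 ltac:(lra))).
rewrite <- !HX by lra.
apply (linear_ode_le_exp X g); auto; try lra.
- intros t Ht; left; apply HXp, Ht.
- intros t Ht; unfold g.
  assert (0 < X t) by (apply HXp, Ht).
  assert (0 < X (t - 1)).
    (* The delayed time falls either in the initial interval or in the range where positivity was
       just derived. *)
    destruct (Rle_lt_dec (t - 1) 0); [apply HX0; lra | apply HXp; lra].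
  assert (0 <= - alpha * X t) by (apply Rmult_le_pos; lra).
  rewrite <- (Rmult_1_r r) at 2.
  apply Rmult_le_compat_l; lra.
Qed.

Lemma blow_up_alpha_pos (r alpha : R) (phi x : R -> R) :
  0 < r -> initial_condition phi -> blow_up_solution r alpha phi x -> 0 < alpha.
Proof.
intros Hr Hphi [T [[Hsol _] Hlim]].
destruct (Rlt_le_dec 0 alpha) as [|Ha]; [assumption | exfalso].
assert (HT : 0 < T) by (destruct Hsol; assumption).
assert (Hbound := solution_le_exp r alpha T phi x Hr Ha Hphi Hsol).
assert (Hx0 : 0 < x 0).
{ destruct Hsol as [_ [_ [Hinit _]]]; rewrite Hinit by lra.
  apply Hphi; lra. }
(* The value [x 0 * exp (r * T)] dominates the exponential bound on all of [(0, T)], yet a function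
   tending to infinity must exceed it. *)
assert (Hbig : at_left T (fun t => x 0 * exp (r * T) < x t)).
{ apply (Hlim (fun y => x 0 * exp (r * T) < y)).
  exists (x 0 * exp (r * T)); auto. }
assert (Hnear : at_left T (fun t => 0 < t < T)).
{ apply (locally_interval (fun t => t < T -> 0 < t < T) T 0 p_infty); simpl; auto. }
destruct (filter_ex _ (filter_and _ _ Hbig Hnear)) as [t [H1 H2]].
assert (Ht := Hbound t H2).
assert (exp (r * t) < exp (r * T))
  by (apply exp_increasing, Rmult_lt_compat_l; lra).
assert (x 0 * exp (r * t) < x 0 * exp (r * T))
  by (apply Rmult_lt_compat_l; lra).
lra.
Qed.

(** * The case [alpha > 0]: an explicit blow-up solution *)

Definition ramp (c theta : R) : R := 1 + (c - 1) * Rmax 0 (2 * theta + 1).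

(** Each piece is frozen on the other side of [0], and both equal [c] there. Subtracting [c] glues
    them into a sum whose continuity needs no case distinction. *)
Definition ramp_solution (c t : R) : R :=
  ramp c (Rmin 0 t) + (c / (1 - 2 * Rmax 0 t) - c).

Lemma continuous_ramp (c t : R) : continuous (ramp c) t.
Proof.
apply (continuous_plus (fun _ => 1)); [apply continuous_const |].
apply (continuous_scal_r (c - 1) (fun u => Rmax 0 (2 * u + 1))).
apply (continuous_comp (fun u => 2 * u + 1) (Rmax 0)).
  apply continuity_pt_filterlim; reg.
apply continuous_Rmax_r.
Qed.

Lemma ramp_initial_condition (c : R) : 0 < c -> initial_condition (ramp c).
Proof.
intros Hc; split.
- intros t Ht; unfold ramp, Rmax; destruct Rle_dec; [|lra].
  assert (0 <= (2 * t + 1) * c) by (apply Rmult_le_pos; lra).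
  (* On the rising part the value is [(2 t + 1) c - 2 t]: strict positivity comes from [c] at
     [t = 0] and from [- 2 t] when [t < 0]. *)
  destruct (Req_dec t 0) as [->|]; lra.
- intros t _; apply filterlim_filter_le_1 with (2 := continuous_ramp c t).
  apply filter_le_within.
Qed.

Lemma ramp_solution_neg (c t : R) : t <= 0 -> ramp_solution c t = ramp c t.
Proof.
intros Ht; unfold ramp_solution.
rewrite Rmin_right, Rmax_left by lra; field.
Qed.

Lemma ramp_solution_early (c t : R) : t <= - / 2 -> ramp_solution c t = 1.
Proof.
intros Ht; rewrite ramp_solution_neg by lra.
unfold ramp; rewrite Rmax_left by lra; ring.
Qed.

Lemma ramp_solution_pos (c t : R) :
  0 <= t -> ramp_solution c t = c / (1 - 2 * t).
Proof.
intros Ht; unfold ramp_solution, ramp.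
rewrite (Rmin_left 0 t), (Rmax_right 0 t), Rmax_right by lra; ring.
Qed.

Lemma continuous_ramp_solution (c t : R) :
  t < / 2 -> continuous (ramp_solution c) t.
Proof.
intros Ht.
apply (continuous_plus (fun t => ramp c (Rmin 0 t))).
  apply (continuous_comp (Rmin 0) (ramp c)).
    apply continuous_Rmin_r.
  apply continuous_ramp.
apply (continuous_comp (Rmax 0) (fun u => c / (1 - 2 * u) - c)).
  apply continuous_Rmax_r.
apply continuity_pt_filterlim; reg.
unfold Rmax; destruct Rle_dec; lra.
Qed.

(** For [0 <= t < 1/2] the delayed value is [1], so the right-hand side is
    [r alpha c^2 / (1 - 2 t)^2]. With [r alpha c = 2] this is [2 c / (1 - 2 t)^2], the derivative of
    [c / (1 - 2 t)]. *)
Lemma ramp_solution_solves (r alpha c : R) :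
  r * alpha * c = 2 -> solution_on r alpha (ramp c) (/ 2) (ramp_solution c).
Proof.
intros Hc; split; [simpl; lra | split; [|split; [|split]]].
- intros t [_ Ht]; simpl in Ht.
  apply filterlim_filter_le_1 with (2 := continuous_ramp_solution c t Ht).
  apply filter_le_within.
- intros t Ht; apply ramp_solution_neg; lra.
- unfold logistic_rhs.
  rewrite (ramp_solution_early c (0 - 1)), ramp_solution_pos by lra.
  (* For [0 < t < 1/2] the difference quotient simplifies exactly to this function, which is
     continuous at [0]. *)
  apply filterlim_ext_loc with (fun t => 2 * c / (1 - 2 * t)).
    apply (locally_interval (fun t => 0 < t -> _) 0 m_infty (/ 2)); simpl; try lra.
    intros t _ H1 H2; rewrite !ramp_solution_pos by lra; field; lra.
  replace (r * _ * _) with (2 * c / (1 - 2 * 0)).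
    apply (filterlim_filter_le_1 (F := locally 0) (G := at_right 0)); [apply filter_le_within |].
    apply (continuity_pt_filterlim (fun t => 2 * c / (1 - 2 * t))); reg; lra.
  rewrite <- Hc; field.
- simpl; intros t H0 Ht.
  apply (is_derive_ext_loc (fun t => c / (1 - 2 * t))).
    apply (locally_interval _ t 0 (/ 2)); simpl; try lra.
    intros u H1 H2; symmetry; apply ramp_solution_pos; lra.
  unfold logistic_rhs.
  rewrite (ramp_solution_early c (t - 1)), ramp_solution_pos by lra.
  auto_derive; [lra |].
  replace (r * _ * _) with (r * alpha * c * c / ((1 - 2 * t) * (1 - 2 * t)))
    by (field; lra).
  rewrite Hc; field; lra.
Qed.

Lemma ramp_solution_blow_up (c : R) :
  0 < c ->
  filterlim (ramp_solution c) (at_left (/ 2)) (Rbar_locally p_infty).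
Proof.
intros Hc P [M HM].
(* A positive threshold allows division: [c / (1 - 2 t) > m] as soon as
   [1/2 - c / (2 m) < t < 1/2]. *)
set (m := Rmax M 1).
assert (H1 : 1 <= m) by apply Rmax_r.
assert (H2 : M <= m) by apply Rmax_l.
assert (Hcm : 0 < c / (2 * m)) by (apply Rdiv_lt_0_compat; lra).
apply (locally_interval (fun t => t < / 2 -> P (ramp_solution c t))
         (/ 2) (Rmax 0 (/ 2 - c / (2 * m))) p_infty); simpl; auto.
  apply Rmax_lub_lt; lra.
intros t Hlt _ Ht.
assert (H3 := Rmax_l 0 (/ 2 - c / (2 * m))).
assert (H4 := Rmax_r 0 (/ 2 - c / (2 * m))).
apply HM; rewrite ramp_solution_pos by lra.
apply Rle_lt_trans with (1 := H2).
apply Rlt_div_r; [lra |].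
assert (H5 : 1 - 2 * t < c / m).
  replace (c / m) with (2 * (c / (2 * m))) by (field; lra); lra.
apply (Rmult_lt_compat_l m) in H5; [|lra].
replace (m * (c / m)) with c in H5 by (field; lra); lra.
Qed.

(** * Maximality and the equivalence *)

(** A proper extension [y] would be continuous at [T], hence below [y T + 1] just left of [T], where
    it coincides with [x], which tends to infinity. *)
Lemma blow_up_maximal (r alpha T : R) (phi x : R -> R) :
  solution_on r alpha phi T x ->
  filterlim x (at_left T) (Rbar_locally p_infty) ->
  maximal_solution r alpha phi T x.
Proof.
intros Hsol Hlim; split; [exact Hsol |].
assert (HT : 0 < T) by (destruct Hsol; assumption).
intros T' y HT' [_ [Hy _]] Heq.
assert (Hnear : at_left T (fun t => -1 <= t < T)).
{ apply (locally_interval (fun t => t < T -> -1 <= t < T) T 0 p_infty); simpl; auto.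
  intros; lra. }
assert (Hbig : at_left T (fun t => y T + 1 < x t)).
{ apply (Hlim (fun z => y T + 1 < z)); exists (y T + 1); auto. }
assert (Hsmall : at_left T (fun t => -1 <= t /\ Rbar_lt t T' -> y t < y T + 1)).
{ apply filter_le_within.
  apply (Hy T (conj (ltac:(lra) : -1 <= T) HT') (fun z => z < y T + 1)).
  apply (open_lt (y T + 1)); lra. }
destruct (filter_ex _ (filter_and _ _ Hnear (filter_and _ _ Hbig Hsmall)))
  as [t [[H1 H2] [H3 H4]]].
assert (H5 : Rbar_lt t T') by (apply Rbar_lt_trans with T; assumption).
specialize (H4 (conj H1 H5)).
rewrite Heq in H4 by assumption; lra.
Qed.

Theorem mainTheorem1 (r alpha : R) (hr : 0 < r) :
  (exists phi x : R -> R,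
     initial_condition phi /\ blow_up_solution r alpha phi x) <->
  0 < alpha.
Proof.
split.
- intros [phi [x [Hphi Hblow]]].
  exact (blow_up_alpha_pos r alpha phi x hr Hphi Hblow).
- intros Ha.
  assert (Hra : 0 < r * alpha) by (apply Rmult_lt_0_compat; assumption).
  set (c := 2 / (r * alpha)).
  assert (Hc : 0 < c) by (apply Rdiv_lt_0_compat; lra).
  exists (ramp c), (ramp_solution c).
  split; [apply ramp_initial_condition, Hc | exists (/ 2)].
  assert (Hlim := ramp_solution_blow_up c Hc).
  split; [apply blow_up_maximal |]; try exact Hlim.
  apply ramp_solution_solves; unfold c; field; lra.
Qed.
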